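(* Let $V$ be a finite-dimensional Hilbert space, let $R:V\otimes V\to V\otimes V$ be an R-matrix, and let $\mu\in\mathbb{C}$ with $|\mu|=1$ be such that $\|R-\mu1\|<1-2^{-1/4}$ (operator norm). Then $R$ is trivial, i.e. $R$ is a scalar multiple of the identity.
   Context: An R-matrix on a finite-dimensional Hilbert space $V$ is a unitary $R$ on $V\otimes V$ satisfying $(R\otimes\mathrm{id}_V)(\mathrm{id}_V\otimes R)(R\otimes\mathrm{id}_V)=(\mathrm{id}_V\otimes R)(R\otimes\mathrm{id}_V)(\mathrm{id}_V\otimes R)$. *)

(* Defs.v *)
From HB Require Import structures.
From mathcomp Require Import all_boot all_order all_algebra.
From mathcomp Require Import complex.
From mathcomp Require Import boolp classical_sets reals exp.

Set Implicit Arguments.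
Unset Strict Implicit.
Unset Printing Implicit Defensive.

Import Order.TTheory GRing.Theory Num.Theory Num.Def.
Local Open Scope ring_scope.

(* A finite-dimensional complex Hilbert space; the inner product is linear in
   its first argument, antilinear in the second. *)
Record hilbert (R : realType) := Hilbert {
  hilbert_sort :> vectType R[i];
  hdot : {dot hilbert_sort for @conjC R[i]}
}.
Arguments hdot {R} h.

Section OrthonormalBasis.
Variables (R : realType) (V : hilbert R).

Lemma orthonormal_basis_ex :
  exists e : (\dim {: V}).-tuple V, orthonormal (hdot V) e.
Proof.
suff on_ex n : (n <= \dim {: V})%N ->
    exists2 s : seq V, size s = n & orthonormal (hdot V) s.
  have [s /eqP sz_s on_s] := on_ex _ (leqnn _).
  by exists (Tuple sz_s).
elim: n => [_|n IHn n_lt]; first by exists [::].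
have [s sz_s on_s] := IHn (ltnW n_lt).
have /subvPn[b _ b_notin] : ~~ (fullv <= <<s>>)%VS.
  apply: contraL n_lt => /dimvS full_le; rewrite -leqNgt.
  by rewrite (leq_trans full_le)// -sz_s dim_span.
have [X Xs [Y [defb _ oY]]] := orthogonal_split (hdot V) s b.
have Y_neq0 : Y != 0.
  by apply: contra b_notin => /eqP Y0; rewrite defb Y0 addr0.
pose a := (sqrtC (hdot V Y Y))^-1; exists (a *: Y :: s); first by rewrite /= sz_s.
rewrite -cat1s orthonormal_cat on_s andTb; apply/andP; split.
  rewrite /orthonormal /= !andbT dnormZ.
  have ge0 := sqrt_dnorm_ge0 (hdot V) Y.
  rewrite ger0_norm ?invr_ge0// exprVn sqrtCK mulVf//.
  by rewrite dnorm_eq0.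
by apply/orthoPl => v vs; rewrite linearZl_LR /= (orthoPl oY _ vs) mulr0.
Qed.

Definition onb : (\dim {: V}).-tuple V := xchoose orthonormal_basis_ex.

Lemma onb_orthonormal : orthonormal (hdot V) onb.
Proof. exact: (xchooseP orthonormal_basis_ex). Qed.

Lemma hdot_onb i j : hdot V onb`_i onb`_j = ((i == j) && (i < \dim {: V})%N)%:R.
Proof.
have /orthonormalP[uniq_e on_e] := onb_orthonormal.
have sz : size onb = \dim {: V} by rewrite size_tuple.
case: (ltnP i (\dim {:V})) => [lti|gei]; last first.
  by rewrite andbF nth_default ?sz// linear0l.
case: (ltnP j (\dim {:V})) => [ltj|gej]; last first.
  rewrite [onb`_j]nth_default ?sz// linear0r andbT.
  by rewrite ltn_eqF// (leq_trans lti).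
by rewrite on_e ?mem_nth ?sz// nth_uniq ?sz// andbT.
Qed.

Lemma onb_expand (u : V) :
  u = \sum_(i < \dim {: V}) hdot V u onb`_i *: onb`_i.
Proof.
have on_e := onb_orthonormal.
have b_e : basis_of {: V} onb.
  by rewrite basisEfree (orthonormal_free on_e) subvf size_tuple leqnn.
rewrite {1 2}(coord_basis b_e (memvf u)).
apply: eq_bigr => i _; congr (_ *: _).
rewrite linear_sumlz (bigD1 i)//= linearZl_LR/= hdot_onb eqxx ltn_ord mulr1.
rewrite big1 ?addr0// => j ji; rewrite linearZl_LR/= hdot_onb.
by rewrite (inj_eq val_inj) (negPf ji) mulr0.
Qed.

End OrthonormalBasis.

Section Tensor.
Variable R : realType.
Local Notation C := R[i].
Implicit Types U V W X : hilbert R.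

(* An element of the tensor product of U and V is the matrix of its
   coordinates in the orthonormal basis formed by the products of the elements
   of onb U and onb V. *)
Section TensorDot.
Variables m n : nat.

Definition tdot (A B : 'M[C]_(m, n)) : C := \sum_i \sum_j A i j * conjC (B i j).

Fact tdot_bilinear : bilinear_for
  (GRing.Scale.Law.clone _ _ *%R _) (GRing.Scale.Law.clone _ _ (conjC \; *%R) _)
  tdot.
Proof.
split=> A a X Y; rewrite /tdot /= mulr_sumr -big_split/=; apply: eq_bigr => i _;
  rewrite mulr_sumr -big_split/=; apply: eq_bigr => j _; rewrite !mxE.
  by rewrite mulrDl mulrA.
by rewrite rmorphD rmorphM mulrDr mulrCA.
Qed.

HB.instance Definition _ :=
  bilinear_isBilinear.Build C _ _ _ _ _ tdot tdot_bilinear.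

Fact tdot_hermitian A B : tdot A B = (-1) ^+ false * conjC (tdot B A).
Proof.
rewrite expr0 mul1r /tdot rmorph_sum/=; apply: eq_bigr => i _.
rewrite rmorph_sum/=; apply: eq_bigr => j _.
by rewrite rmorphM /= conjCK mulrC.
Qed.

HB.instance Definition _ :=
  isHermitianSesquilinear.Build C _ false conjC tdot tdot_hermitian.

Fact tdot_gt0 A : A != 0 -> 0 < tdot A A.
Proof.
move=> A_neq0; rewrite lt_def; apply/andP; split; last first.
  by do 2!apply: sumr_ge0 => ? _; exact: mul_conjC_ge0.
apply: contra A_neq0; rewrite psumr_eq0 => [|i _]; last first.
  by apply: sumr_ge0 => ? _; exact: mul_conjC_ge0.
move=> /allP A0; apply/eqP/matrixP => i j; rewrite mxE.
have := A0 i (mem_index_enum _); rewrite psumr_eq0 => [|k _]; last first.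
  exact: mul_conjC_ge0.
by move=> /allP/(_ j (mem_index_enum _)); rewrite mul_conjC_eq0 => /eqP.
Qed.

HB.instance Definition _ := isDotProduct.Build C _ tdot tdot_gt0.

End TensorDot.

Definition tensor U V : hilbert R :=
  @Hilbert R 'M[C]_(\dim {: U}, \dim {: V}) (@tdot _ _).

Local Notation "U \otimes V" := (tensor U V) (at level 40, left associativity).

Definition tens U V (u : U) (v : V) : U \otimes V :=
  \matrix_(i, j) (hdot U u (onb U)`_i * hdot V v (onb V)`_j).

(* The linear map out of the tensor product induced by b, meant for b
   bilinear. *)
Definition tlift_fun U V W (b : U -> V -> W) (A : U \otimes V) : W :=
  \sum_i \sum_j (A : 'M_(_, _)) i j *: b (onb U)`_i (onb V)`_j.

Fact tlift_fun_linear U V W (b : U -> V -> W) : linear (tlift_fun b).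
Proof.
move=> a A B; rewrite /tlift_fun scaler_sumr -big_split; apply: eq_bigr => i _.
rewrite scaler_sumr -big_split; apply: eq_bigr => j _ /=.
by rewrite !mxE scalerDl scalerA.
Qed.

HB.instance Definition _ U V W (b : U -> V -> W) :=
  GRing.isLinear.Build C (U \otimes V) W *:%R (tlift_fun b)
    (tlift_fun_linear b).

Definition tlift U V W (b : U -> V -> W) : 'Hom(U \otimes V, W) :=
  linfun (tlift_fun b).

Definition tensf U V U' V' (f : 'Hom(U, U')) (g : 'Hom(V, V')) :
    'Hom(U \otimes V, U' \otimes V') :=
  tlift (fun u v => tens (f u) (g v)).

Definition tassoc U V W :
    'Hom((U \otimes V) \otimes W, U \otimes (V \otimes W)) :=
  tlift (fun t w => tlift (fun u v => tens u (tens v w)) t).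

Definition tassocV U V W :
    'Hom(U \otimes (V \otimes W), (U \otimes V) \otimes W) :=
  tlift (fun u t => tlift (fun v w => tens (tens u v) w) t).

(* tliftE, tensfE, tassocE and hdot_tens characterize these constructions on
   pure tensors, independently of the choice of onb. *)
Lemma tensPl U V a (u u' : U) (v : V) :
  tens (a *: u + u') v = a *: tens u v + tens u' v.
Proof.
apply/matrixP => i j; rewrite !mxE.
by rewrite linearDl linearZl_LR/= mulrDl mulrA.
Qed.

Lemma tensPr U V a (u : U) (v v' : V) :
  tens u (a *: v + v') = a *: tens u v + tens u v'.
Proof.
apply/matrixP => i j; rewrite !mxE.
by rewrite linearDl linearZl_LR/= mulrDr mulrCA.
Qed.

Lemma hdot_tens U V (u u' : U) (v v' : V) :
  hdot (U \otimes V) (tens u v) (tens u' v') = hdot U u u' * hdot V v v'.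
Proof.
have parseval W (x y : W) : hdot W x y =
    \sum_(i < \dim {: W}) hdot W x (onb W)`_i * conjC (hdot W y (onb W)`_i).
  rewrite {1}(onb_expand y) linear_sumr; apply: eq_bigr => i _.
  by rewrite linearZr_LR /= mulrC.
rewrite /= /tdot (parseval U) (parseval V) mulr_suml; apply: eq_bigr => i _.
rewrite mulr_sumr; apply: eq_bigr => j _; rewrite !mxE rmorphM.
by rewrite mulrACA.
Qed.

Lemma tens_onb U V (A : U \otimes V) :
  A = \sum_i \sum_j (A : 'M_(_, _)) i j *: tens (onb U)`_i (onb V)`_j.
Proof.
apply/matrixP => k l; rewrite summxE (bigD1 k)//= summxE (bigD1 l)//=.
rewrite !mxE !hdot_onb !eqxx !ltn_ord !mulr1 !big1 ?addr0// => [i ik|j jl].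
  rewrite summxE big1// => j _; rewrite !mxE !hdot_onb.
  by rewrite (inj_eq val_inj) (negPf ik) mul0r mulr0.
by rewrite !mxE !hdot_onb (inj_eq val_inj (j : ordinal _)) (negPf jl) !mulr0.
Qed.

Lemma tliftE U V W (b : {bilinear U -> V -> W}) u v :
  tlift b (tens u v) = b u v.
Proof.
rewrite lfunE [in RHS](onb_expand u) [in RHS](onb_expand v) /= /tlift_fun.
rewrite linear_sumlz; apply: eq_bigr => i _.
rewrite linear_sumr; apply: eq_bigr => j _.
by rewrite !mxE linearZl_LR linearZr_LR /= scalerA.
Qed.

Lemma tensfE U V U' V' (f : 'Hom(U, U')) (g : 'Hom(V, V')) u v :
  tensf f g (tens u v) = tens (f u) (g v).
Proof.
have b_bil : bilinear_for (GRing.Scale.Law.clone _ _ *:%R _)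
    (GRing.Scale.Law.clone _ _ *:%R _) (fun u v => tens (f u) (g v)).
  by split=> x a y z /=; rewrite linearP (tensPl, tensPr).
pose b0 u v := tens (f u) (g v).
pose b : {bilinear U -> V -> U' \otimes V'} := HB.pack b0
  (bilinear_isBilinear.Build _ _ _ _ _ _ b0 b_bil).
exact: (tliftE b).
Qed.

Lemma tassocE U V W (u : U) (v : V) (w : W) :
  tassoc U V W (tens (tens u v) w) = tens u (tens v w).
Proof.
have b_bil (w' : W) : bilinear_for (GRing.Scale.Law.clone _ _ *:%R _)
    (GRing.Scale.Law.clone _ _ *:%R _) (fun (u : U) (v : V) => tens u (tens v w')).
  by split=> x a y z /=; rewrite ?tensPl ?tensPr.
pose b0 w' u v : U \otimes (V \otimes W) := tens u (tens v w').
pose b w' : {bilinear U -> V -> U \otimes (V \otimes W)} := HB.pack (b0 w')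
  (bilinear_isBilinear.Build _ _ _ _ _ _ (b0 w') (b_bil w')).
pose c0 t w' := tlift (b0 w') t.
have c_bil : bilinear_for (GRing.Scale.Law.clone _ _ *:%R _)
    (GRing.Scale.Law.clone _ _ *:%R _) c0.
  split=> x a y z /=; rewrite /c0 ?linearP// !lfunE /= /tlift_fun.
  rewrite scaler_sumr -big_split; apply: eq_bigr => i _.
  rewrite scaler_sumr -big_split; apply: eq_bigr => j _ /=.
  rewrite /b0 !tensPr.
  by rewrite scalerDr !scalerA [_ * a]mulrC.
pose c : {bilinear U \otimes V -> W -> U \otimes (V \otimes W)} := HB.pack c0
  (bilinear_isBilinear.Build _ _ _ _ _ _ c0 c_bil).
by rewrite (tliftE c) /= /c0 (tliftE (b w)).
Qed.

Lemma hom_tensP U V W (f g : 'Hom(U \otimes V, W)) :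
  (forall u v, f (tens u v) = g (tens u v)) -> f = g.
Proof.
move=> fg; apply/lfunP => A; rewrite (tens_onb A) !linear_sum.
apply: eq_bigr => i _; rewrite !linear_sum; apply: eq_bigr => j _.
by rewrite !linearZ /= fg.
Qed.

Lemma tassocVE U V W (u : U) (v : V) (w : W) :
  tassocV U V W (tens u (tens v w)) = tens (tens u v) w.
Proof.
have b_bil (u' : U) : bilinear_for (GRing.Scale.Law.clone _ _ *:%R _)
    (GRing.Scale.Law.clone _ _ *:%R _) (fun (v : V) (w : W) => tens (tens u' v) w).
  by split=> x a y z /=; rewrite ?tensPr ?tensPl.
pose b0 u' v w : U \otimes V \otimes W := tens (tens u' v) w.
pose b u' : {bilinear V -> W -> U \otimes V \otimes W} := HB.pack (b0 u')
  (bilinear_isBilinear.Build _ _ _ _ _ _ (b0 u') (b_bil u')).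
pose c0 u' t := tlift (b0 u') t.
have c_bil : bilinear_for (GRing.Scale.Law.clone _ _ *:%R _)
    (GRing.Scale.Law.clone _ _ *:%R _) c0.
  split=> x a y z /=; rewrite /c0 ?linearP// !lfunE /= /tlift_fun.
  rewrite scaler_sumr -big_split; apply: eq_bigr => i _.
  rewrite scaler_sumr -big_split; apply: eq_bigr => j _ /=.
  rewrite /b0 !tensPl.
  by rewrite scalerDr !scalerA [_ * a]mulrC.
pose c : {bilinear U -> V \otimes W -> U \otimes V \otimes W} := HB.pack c0
  (bilinear_isBilinear.Build _ _ _ _ _ _ c0 c_bil).
by rewrite (tliftE c) /= /c0 (tliftE (b u)).
Qed.

Lemma hom_tens3lP U V W X (f g : 'Hom(U \otimes V \otimes W, X)) :
  (forall u v w, f (tens (tens u v) w) = g (tens (tens u v) w)) -> f = g.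
Proof.
move=> fg; apply: (@hom_tensP (U \otimes V) W X) => t w.
have tens_lin : linear (fun t : U \otimes V => tens t w).
  by move=> a x y; rewrite tensPl.
pose l : 'Hom(U \otimes V, U \otimes V \otimes W) :=
  linfun (HB.pack (fun t : U \otimes V => tens t w)
    (GRing.isLinear.Build _ _ _ _ _ tens_lin) : {linear _ -> _}).
have lE t' : l t' = tens t' w by rewrite lfunE.
have /lfunP/(_ t) : (f \o l)%VF = (g \o l)%VF.
  apply: (@hom_tensP U V X) => u v.
  by rewrite !comp_lfunE !lE fg.
by rewrite !comp_lfunE !lE.
Qed.

Lemma hom_tens3rP U V W X (f g : 'Hom(U \otimes (V \otimes W), X)) :
  (forall u v w, f (tens u (tens v w)) = g (tens u (tens v w))) -> f = g.
Proof.
move=> fg; apply: (@hom_tensP U (V \otimes W) X) => u t.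
have tens_lin : linear (fun t : V \otimes W => tens u t).
  by move=> a x y; rewrite tensPr.
pose l : 'Hom(V \otimes W, U \otimes (V \otimes W)) :=
  linfun (HB.pack (fun t : V \otimes W => tens u t)
    (GRing.isLinear.Build _ _ _ _ _ tens_lin) : {linear _ -> _}).
have lE t' : l t' = tens u t' by rewrite lfunE.
have /lfunP/(_ t) : (f \o l)%VF = (g \o l)%VF.
  apply: (@hom_tensP V W X) => v w.
  by rewrite !comp_lfunE !lE fg.
by rewrite !comp_lfunE !lE.
Qed.

Lemma tassocK U V W : (tassocV U V W \o tassoc U V W = \1)%VF.
Proof.
apply: (@hom_tens3lP U V W (U \otimes V \otimes W)) => u v w.
by rewrite comp_lfunE id_lfunE tassocE tassocVE.
Qed.

Lemma tassocVK U V W : (tassoc U V W \o tassocV U V W = \1)%VF.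
Proof.
apply: (@hom_tens3rP U V W (U \otimes (V \otimes W))) => u v w.
by rewrite comp_lfunE id_lfunE tassocVE tassocE.
Qed.

Definition unitary_op U V (f : 'Hom(U, V)) : Prop :=
  isometry (hdot V) (hdot U) f /\ limg f = fullv.

Definition Rmatrix V (T : 'End(V \otimes V)) : Prop :=
  unitary_op T /\
  let T12 := tensf T \1%VF in
  let T23 := (tassocV V V V \o tensf \1 T \o tassoc V V V)%VF in
  (T12 \o T23 \o T12 = T23 \o T12 \o T23)%VF.

Definition hnorm V (v : V) : R := Num.sqrt (complex.Re (hdot V v v)).

Definition opnorm U V (f : 'Hom(U, V)) : R :=
  sup [set hnorm (f u) | u in [set u : U | hnorm u <= 1]].

Lemma hnormE V (v : V) : (hnorm v)%:C%C = sqrtC (hdot V v v).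
Proof.
have := dnorm_ge0 (hdot V) v.
rewrite /hnorm; case: (hdot V v v) => a b; rewrite lecE /= => /andP[/eqP -> a0].
rewrite -[in RHS](sqr_sqrtr a0).
have -> : (Num.sqrt a ^+ 2 +i* 0)%C = ((Num.sqrt a)%:C%C) ^+ 2 :> C.
  by rewrite -rmorphXn.
by rewrite sqrCK// lecE /= eqxx sqrtr_ge0.
Qed.

Lemma hnorm_triangle V (u v : V) : hnorm (u + v) <= hnorm u + hnorm v.
Proof. by rewrite -lecR rmorphD/= !hnormE triangle_lerif. Qed.

Lemma hnormZ V a (v : V) : hnorm (a *: v) = complex.Re `|a| * hnorm v.
Proof.
apply: complexI; rewrite rmorphM /= !hnormE dnormZ.
by rewrite sqrtCM ?qualifE/= ?exprn_ge0 ?dnorm_ge0// sqrCK//.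
Qed.

(* sup is 0 on unbounded sets; this case does not occur in opnorm. *)
Lemma opnorm_has_sup U V (f : 'Hom(U, V)) :
  has_sup [set hnorm (f u) | u in [set u : U | hnorm u <= 1]].
Proof.
have hnorm0 (W : hilbert R) : hnorm (0 : W) = 0.
  by rewrite -(scale0r 0) hnormZ normr0 mul0r.
split; first by exists (hnorm (f 0)); exists 0; rewrite //= hnorm0.
exists (\sum_(i < \dim {: U}) hnorm (f (onb U)`_i)) => _ [u /= u1 <-].
rewrite {1}(onb_expand u) linear_sum /=.
have hnorm_sum n (F : 'I_n -> V) :
    hnorm (\sum_(i < n) F i) <= \sum_(i < n) hnorm (F i).
  elim/big_ind2 : _ => [|x a y b xa yb|//]; first by rewrite hnorm0.
  by rewrite (le_trans (hnorm_triangle _ _))// lerD.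
apply: le_trans (hnorm_sum _ _) _; apply: ler_sum => i _.
rewrite linearZ hnormZ -[leRHS]mul1r ler_wpM2r ?sqrtr_ge0//.
rewrite -lecR RRe_real ?normr_real//.
apply: le_trans (CauchySchwarz_sqrt _ _ _) _.
by rewrite hdot_onb eqxx ltn_ord sqrtC1 mulr1 -hnormE lecR.
Qed.

End Tensor.

Notation "U \otimes V" := (tensor U V) (at level 40, left associativity).

(* Main.v *)
From HB Require Import structures.
Require Import Defs.
From mathcomp Require Import all_boot all_order all_algebra.
From mathcomp Require Import complex.
From mathcomp Require Import lra.
From mathcomp Require Import reals exp.

(** On the triple tensor power of V put A = R (x) 1 and B = 1 (x) R, two
    unitaries with ABA = BAB.  Write a = A - mu and D = A - B.  The braid
    relation turns into

      D A B = A^2 B - B A B = A^2 B - A B A = A (A B - B A) = A (D a - a D),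

    the last equality because AB - BA is the commutator of D = A - B with A,
    hence with a.  As A and B are unitary, taking norms gives
    |D| <= 2 |a| |D|, so that D = 0 as soon as |a| < 1/2
    ([braid_near_scalar_eq]).  Since |a| <= |R - mu| ([opnorm_tensf1]) and
    1 - 2^(-1/4) <= 1/2, this applies to every R-matrix as in the theorem, and
    R (x) 1 = 1 (x) R.

    It remains to see that such an R is scalar ([tensf1_eq_1tensf_scalar]): the
    left-hand side acts trivially on the third factor and the right-hand side
    on the first, so the matrix coefficients of R satisfy
      <R (u (x) v), x (x) y> <w, z> = <u, x> <R (v (x) w), y (x) z>,
    and using this twice, with a fixed unit vector in the free slots, expresses
    them all by a single one. *)

Import Order.TTheory GRing.Theory Num.Theory.
Local Open Scope ring_scope.

Section YangBaxterRigidity.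
Local Set Implicit Arguments.
Local Unset Strict Implicit.
Variable K : realType.
Local Notation C := K[i].
Implicit Types U V W H : hilbert K.

(** * The operator norm *)

Lemma hdot_inj V (x y : V) : (forall z, hdot V x z = hdot V y z) -> x = y.
Proof.
move=> xy; rewrite (onb_expand x) (onb_expand y).
by apply: eq_bigr => i _; rewrite xy.
Qed.

Lemma hnorm_ge0 V (x : V) : 0 <= hnorm x.
Proof. exact: sqrtr_ge0. Qed.

Lemma hnorm_sqr V (x : V) : (hnorm x ^+ 2)%:C%C = hdot V x x.
Proof. by rewrite rmorphXn /= hnormE sqrtCK. Qed.

Lemma hnorm_eq0 V (x : V) : (hnorm x == 0) = (x == 0).
Proof.
by rewrite -(dnorm_eq0 (hdot V)) -hnorm_sqr fmorph_eq0 sqrf_eq0.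
Qed.

Lemma hnorm0 V : hnorm (0 : V) = 0.
Proof. by apply/eqP; rewrite hnorm_eq0. Qed.

Lemma hnormN V (x : V) : hnorm (- x) = hnorm x.
Proof. by rewrite -scaleN1r hnormZ normrN1 /= mul1r. Qed.

Lemma isometry_hnorm U V (f : 'Hom(U, V)) :
  isometry (hdot V) (hdot U) f -> forall x, hnorm (f x) = hnorm x.
Proof. by move=> iso_f x; rewrite /hnorm iso_f. Qed.

Lemma opnorm_ge0 U V (f : 'Hom(U, V)) : 0 <= opnorm f.
Proof.
apply: le_trans (hnorm_ge0 (f 0)) _.
apply: ub_le_sup; first by have [] := opnorm_has_sup f.
by exists 0; rewrite //= hnorm0.
Qed.

Lemma hnorm_opnorm U V (f : 'Hom(U, V)) x : hnorm (f x) <= opnorm f * hnorm x.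
Proof.
have [->|x0] := eqVneq x 0; first by rewrite linear0 !hnorm0 mulr0.
have nx_gt0 : 0 < hnorm x by rewrite lt_def hnorm_eq0 x0 hnorm_ge0.
have absV : complex.Re `|((hnorm x)^-1)%:C%C : C| = (hnorm x)^-1.
  by rewrite ger0_norm // -(rmorph0 (real_complex K)) lecR invr_ge0 ltW.
rewrite -ler_pdivrMr // mulrC -absV -hnormZ -linearZ.
apply: ub_le_sup; first by have [] := opnorm_has_sup f.
by eexists; last reflexivity; rewrite /= hnormZ absV mulVf ?gt_eqF.
Qed.

Lemma opnorm_le U V (f : 'Hom(U, V)) c :
  0 <= c -> (forall x, hnorm (f x) <= c * hnorm x) -> opnorm f <= c.
Proof.
move=> c0 fc; apply: ge_sup; first by have [] := opnorm_has_sup f.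
by move=> _ [x /= x1 <-]; rewrite (le_trans (fc x)) // ler_piMr.
Qed.

Lemma opnorm_le0 U V (f : 'Hom(U, V)) : opnorm f <= 0 -> f = 0.
Proof.
move=> f0; apply/lfunP => x; rewrite lfunE /=; apply/eqP.
rewrite -hnorm_eq0 eq_le hnorm_ge0 andbT.
by rewrite (le_trans (hnorm_opnorm _ _)) // mulr_le0_ge0 ?hnorm_ge0.
Qed.

(** * Braid relations near a scalar *)

(** An isometry is injective, hence onto in finite dimension; this is how norm
    bounds on D A B become bounds on D. *)
Lemma isometry_surj H (f : 'End(H)) :
  isometry (hdot H) (hdot H) f -> forall y, exists x, y = f x.
Proof.
move=> iso_f y; have /lker0P inj_f : injective f.
  move=> x x' fxx'; apply/eqP; rewrite -subr_eq0 -hnorm_eq0.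
  by rewrite -(isometry_hnorm iso_f) linearB /= fxx' subrr hnorm0.
by have /memv_imgP[x _ ->] : y \in limg f; [rewrite lker0_limgf ?memvf | exists x].
Qed.

(** A contraction argument: the braid relation bounds A - B by the commutator of
    A - B with the small operator A - mu, that is, by less than itself. *)
Lemma braid_near_scalar_eq H (A B : 'End(H)) mu :
    isometry (hdot H) (hdot H) A -> isometry (hdot H) (hdot H) B ->
    (A \o B \o A = B \o A \o B)%VF ->
    opnorm (A - mu *: \1%VF) < 2^-1 ->
  A = B.
Proof.
move=> iso_A iso_B braid; set a := A - _ => a_lt.
apply/subr0_eq; set D := A - B.
have braidE x : A (B (A x)) = B (A (B x)) by rewrite -!comp_lfunE braid.
have key x : D (A (B x)) = A (D (a x) - a (D x)).
  have aE z : a z = A z - mu *: z by rewrite add_lfunE opp_lfunE scale_lfunE id_lfunE.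
  have DE z : D z = A z - B z by rewrite add_lfunE opp_lfunE.
  (* The scalar mu cancels in the commutator, and [D, A] = AB - BA. *)
  have -> : D (a x) - a (D x) = A (B x) - B (A x).
    rewrite !aE [D (_ - _)]linearB /= [D (_ *: _)]linearZ /= opprB.
    by rewrite addrA subrK !DE [A (_ - _)]linearB /= opprB addrC addrA subrK.
  by rewrite DE linearB /= braidE.
apply: opnorm_le0; set d := opnorm D; set e := opnorm a in a_lt.
have d0 : 0 <= d := opnorm_ge0 D; have e0 : 0 <= e := opnorm_ge0 a.
have : d <= 2 * e * d.
  apply: opnorm_le => [|y]; first by rewrite !mulr_ge0.
  have [z ->] := isometry_surj iso_A y; have [x ->] := isometry_surj iso_B z.
  rewrite key !(isometry_hnorm iso_A) (isometry_hnorm iso_B).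
  have := hnorm_triangle (D (a x)) (- a (D x)); rewrite hnormN.
  have := hnorm_opnorm D (a x); have := hnorm_opnorm a (D x).
  have := ler_wpM2l d0 (hnorm_opnorm a x); have := ler_wpM2l e0 (hnorm_opnorm D x).
  rewrite -/d -/e; lra.
nra.
Qed.

(** * Isometries between tensor products *)

Lemma lfun_tens_onb U V W (f : 'Hom(U \otimes V, W)) t :
  f t = \sum_i \sum_j (t : 'M_(_, _)) i j *: f (tens (onb U)`_i (onb V)`_j).
Proof.
rewrite {1}(tens_onb t) linear_sum; apply: eq_bigr => i _.
by rewrite linear_sum; apply: eq_bigr => j _; rewrite linearZ.
Qed.

(** A sesquilinear form on two tensor products is determined by its values on
    pure tensors.  Both arguments have their own map f or g, so that triple
    tensors can be reached by using the lemma twice, with f and g of the form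
    _ (x) w and _ (x) w' for different w and w'. *)
Lemma hdot_tens_ext U V U' V' W W' (f : 'Hom(U \otimes V, W))
    (g : 'Hom(U' \otimes V', W)) (f' : 'Hom(U \otimes V, W'))
    (g' : 'Hom(U' \otimes V', W')) :
    (forall u v u' v', hdot W (f (tens u v)) (g (tens u' v')) =
                       hdot W' (f' (tens u v)) (g' (tens u' v'))) ->
  forall s t, hdot W (f s) (g t) = hdot W' (f' s) (g' t).
Proof.
move=> fg s t; rewrite !(lfun_tens_onb _ s) !(lfun_tens_onb _ t).
rewrite !linear_sumlz; apply: eq_bigr => i _.
rewrite !linear_sumlz; apply: eq_bigr => j _.
rewrite !linear_sumr; apply: eq_bigr => k _.
rewrite !linear_sumr; apply: eq_bigr => l _.
by rewrite !linearZl_LR !linearZr_LR /= fg.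
Qed.

Fact tensr_linear U W (w : W) : linear (fun u : U => tens u w).
Proof. by move=> c x y; rewrite tensPl. Qed.

Definition tensr U W (w : W) : 'Hom(U, U \otimes W) :=
  linfun (HB.pack (fun u : U => tens u w)
    (GRing.isLinear.Build _ _ _ _ _ (@tensr_linear U W w)) : {linear _ -> _}).

Lemma tensrE U W (w : W) (u : U) : tensr U w u = tens u w.
Proof. by rewrite lfunE. Qed.

Lemma tensf_isometry U V U' V' (f : 'Hom(U, U')) (g : 'Hom(V, V')) :
  isometry (hdot U') (hdot U) f -> isometry (hdot V') (hdot V) g ->
  isometry (hdot (U' \otimes V')) (hdot (U \otimes V)) (tensf f g).
Proof.
move=> iso_f iso_g s t.
rewrite -[in RHS](id_lfunE s) -[in RHS](id_lfunE t).
apply: (@hdot_tens_ext U V U V) => u v u' v'.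
by rewrite !id_lfunE !tensfE !hdot_tens iso_f iso_g.
Qed.

Lemma tassoc_isometry U V W :
  isometry (hdot (U \otimes (V \otimes W))) (hdot (U \otimes V \otimes W))
    (tassoc U V W).
Proof.
move=> s t; rewrite -[in RHS](id_lfunE s) -[in RHS](id_lfunE t).
apply: (@hdot_tens_ext (U \otimes V) W (U \otimes V) W) => x w y w'.
rewrite -!tensrE -!comp_lfunE.
apply: (@hdot_tens_ext U V U V) => u v u' v'.
by rewrite !comp_lfunE !tensrE !id_lfunE !tassocE !hdot_tens mulrA.
Qed.

Lemma tassocV_isometry U V W :
  isometry (hdot (U \otimes V \otimes W)) (hdot (U \otimes (V \otimes W)))
    (tassocV U V W).
Proof.
by move=> s t; rewrite -tassoc_isometry -!comp_lfunE tassocVK !id_lfunE.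
Qed.

(** Columns of the coordinate matrix: U (x) W is an orthogonal sum of copies of
    U indexed by the basis of W, on which f (x) 1 acts as f in each copy.
    [hnorm_slices] is the corresponding Pythagorean identity, and together they
    reduce the norm of f (x) 1 to that of f. *)
Lemma tensor_slices U W (t : U \otimes W) :
  exists x : 'I_(\dim {: W}) -> U, t = \sum_j tens (x j) (onb W)`_j.
Proof.
exists (fun j => \sum_i (t : 'M_(_, _)) i j *: (onb U)`_i).
rewrite [LHS](tens_onb t) exchange_big; apply: eq_bigr => j _ /=.
rewrite -tensrE linear_sum; apply: eq_bigr => i _ /=.
by rewrite linearZ /= tensrE.
Qed.

Lemma hnorm_slices U W (x : 'I_(\dim {: W}) -> U) :
  hnorm (\sum_j tens (x j) (onb W)`_j) ^+ 2 = \sum_j hnorm (x j) ^+ 2.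
Proof.
apply: complexI; rewrite hnorm_sqr rmorph_sum /= linear_sumlz.
apply: eq_bigr => j _; rewrite linear_sumr (bigD1 j) //= big1.
  by rewrite addr0 hnorm_sqr hdot_tens hdot_onb eqxx ltn_ord mulr1.
move=> k kj; rewrite hdot_tens hdot_onb.
by rewrite (inj_eq val_inj) eq_sym (negPf kj) mulr0.
Qed.

Lemma opnorm_tensf1 U U' W (f : 'Hom(U, U')) :
  opnorm (tensf f (\1%VF : 'End(W))) <= opnorm f.
Proof.
apply: opnorm_le => [|t]; first exact: opnorm_ge0.
have [x ->] := tensor_slices t; rewrite linear_sum /=.
under eq_bigr do rewrite tensfE id_lfunE.
rewrite -ler_sqr ?qualifE /= ?mulr_ge0 ?hnorm_ge0 ?opnorm_ge0 //.
rewrite exprMn !hnorm_slices mulr_sumr; apply: ler_sum => j _.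
rewrite -exprMn ler_sqr ?qualifE /= ?mulr_ge0 ?hnorm_ge0 ?opnorm_ge0 //.
exact: hnorm_opnorm.
Qed.

Lemma tensf1_sub_scalar U W (f : 'End(U)) mu :
  tensf (f - mu *: \1%VF) (\1%VF : 'End(W)) = tensf f \1%VF - mu *: \1%VF.
Proof.
apply: (@hom_tensP _ U W) => u w.
rewrite tensfE !(add_lfunE, opp_lfunE, scale_lfunE, id_lfunE) tensfE id_lfunE.
by rewrite -!tensrE linearB linearZ.
Qed.

(** * Operators on two factors that shift to the neighbouring pair *)

(** If R (x) 1 = 1 (x) R, both act trivially on the third factor and on the
    first one, which moves a matrix coefficient of R one slot to the right;
    two such moves push every vector out of it. *)
Lemma tensf1_eq_1tensf_scalar V (R : 'End(V \otimes V)) :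
    tensf R (\1%VF : 'End(V)) =
      (tassocV V V V \o tensf \1 R \o tassoc V V V)%VF ->
  exists c, R = c *: \1%VF.
Proof.
move=> shift.
have shiftE u v w : tassoc V V V (tens (R (tens u v)) w) = tens u (R (tens v w)).
  have /lfunP/(_ (tens (tens u v) w)) := shift.
  rewrite !comp_lfunE tassocE !tensfE !id_lfunE => ->.
  by rewrite -[LHS]comp_lfunE tassocVK id_lfunE.
pose F u v x y := hdot (V \otimes V) (R (tens u v)) (tens x y).
have FE u v w x y z : F u v x y * hdot V w z = hdot V u x * F v w y z.
  by rewrite -!hdot_tens -tassoc_isometry tassocE shiftE.
(* The argument needs a unit vector e to fill the vacated slots. *)
have [dim0|dim_gt0] := posnP (\dim {: V}).
  have /eqP V0 : fullv == 0%VS :> {vspace V} by rewrite -dimv_eq0 dim0.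
  exists 0; apply: (@hom_tensP _ V V) => u v; have := memvf u.
  by rewrite V0 memv0 => /eqP ->; rewrite -!tensrE !linear0.
pose e := (onb V)`_0; have ee : hdot V e e = 1 by rewrite hdot_onb dim_gt0.
exists (F e e e e); apply/lfunP => s; apply: hdot_inj => t.
rewrite -(id_lfunE t); apply: (@hdot_tens_ext V V V V) => u v x y.
rewrite scale_lfunE !id_lfunE linearZl_LR /= hdot_tens -/(F u v x y).
(* First u, x leave the coefficient of R, then v, y. *)
have := FE v e e y e e; have := FE u v e x y e.
by rewrite ee !mulr1 => -> ->; rewrite [LHS]mulrA [LHS]mulrC.
Qed.

End YangBaxterRigidity.

Theorem corollary6p5 (K : realType) (V : hilbert K) (R : 'End(V \otimes V))
    (mu : K[i]) :
  Rmatrix R ->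
  `|mu| = 1 ->
  opnorm (R - mu *: \1%VF) < 1 - 2 `^ (- 4^-1) ->
  exists c : K[i], R = c *: \1%VF.
Proof.
move=> [[iso_R _] /= braid] _ R_near; apply: tensf1_eq_1tensf_scalar.
have iso1 : isometry (hdot V) (hdot V) (\1%VF : 'End(V)).
  by move=> u v; rewrite !id_lfunE.
apply: (@braid_near_scalar_eq K (V \otimes V \otimes V) _ _ mu _ _ braid).
- exact: tensf_isometry.
- move=> s t; rewrite !comp_lfunE tassocV_isometry.
  by rewrite (tensf_isometry iso1 iso_R) tassoc_isometry.
rewrite -tensf1_sub_scalar.
apply: (le_lt_trans (opnorm_tensf1 V (R - mu *: \1%VF))).
have : 2^-1 <= 2 `^ (- 4^-1) :> K by rewrite -powR_inv1 // ler_powR //; lra.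
lra.
Qed.
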